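(* Let $\Omega\subset\mathbb{R}^d$ be nonempty, open and bounded and let $\gamma:\mathbb{R}^d\times\mathbb{R}^d\to[0,\infty)$ be measurable. Let $k:\mathbb{R}^d\times\mathbb{R}^d\to[0,\infty)$ be measurable with $k>0$ and $$\Big\|\int_{\mathbb{R}^d}k(y,\cdot)\,dy\Big\|_{L^\infty(\Omega)}<\infty,$$ and set $$\widetilde\gamma(y,x):=\max\Big\{\gamma(y,x),\ \frac{(\gamma(x,y)-\gamma(y,x))^2}{k(y,x)}\Big\}.$$ If $u\in\mathrm{V}(\Omega;\widetilde\gamma)$ satisfies $$\int_\Omega\Big(\int_{\mathbb{R}^d}|u(x)\gamma(x,y)-u(y)\gamma(y,x)|\,dy\Big)^2dx<\infty,$$ then for all $v\in\mathrm{V}(\Omega;\widetilde\gamma)$ $$\begin{aligned}&\int_\Omega\mathcal{L}u(x)\,v(x)\,dx+\int_{\widehat\Gamma}\mathcal{N}u(y)\,v(y)\,dy\\ &=\frac12\int_\Omega\int_\Omega(u(x)\gamma(x,y)-u(y)\gamma(y,x))(v(x)-v(y))\,dy\,dx\\ &\quad+\int_\Omega\int_{\widehat\Gamma}(u(x)\gamma(x,y)-u(y)\gamma(y,x))(v(x)-v(y))\,dy\,dx.\end{aligned}$$ In particular, $$\int_\Omega-\mathcal{L}u(x)\,dx=\int_{\widehat\Gamma}\mathcal{N}u(y)\,dy.$$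
   Context: Measurability is with respect to Lebesgue measure. For a measurable kernel $\gamma:\mathbb{R}^d\times\mathbb{R}^d\to[0,\infty)$, $$\mathcal{L}u(x):=\int_{\mathbb{R}^d}u(x)\gamma(x,y)-u(y)\gamma(y,x)\,dy\ (x\in\Omega),\qquad \mathcal{N}u(y):=\int_\Omega u(y)\gamma(y,x)-u(x)\gamma(x,y)\,dx\ (y\in\widehat\Gamma),$$ where $\widehat\Gamma:=\{y\in\mathbb{R}^d\setminus\Omega:\int_\Omega\gamma(y,x)+\gamma(x,y)\,dx>0\}$. For a measurable kernel $\eta:\mathbb{R}^d\times\mathbb{R}^d\to[0,\infty)$ let $\Gamma(\Omega,\eta):=\{y\in\mathbb{R}^d\setminus\Omega:\int_\Omega\eta(y,x)\,dx>0\}$; $\mathrm{V}(\Omega;\eta)$ is the space of measurable $v:\mathbb{R}^d\to\mathbb{R}$ with $$\|v\|_{\mathrm{V}(\Omega;\eta)}^2:=\int_\Omega v^2(x)\,dx+\int_\Omega\int_{\mathbb{R}^d}(v(x)-v(y))^2\eta(y,x)\,dy\,dx<\infty,$$ where functions that agree a.e. on $\Omega\cup\Gamma(\Omega,\eta)$ are identified. *)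

(* Defs.v *)
From HB Require Import structures.
From mathcomp Require Import all_boot all_order all_algebra.
From mathcomp Require Import all_classical all_reals all_analysis.

Set Implicit Arguments.
Unset Strict Implicit.
Unset Printing Implicit Defensive.

Import Order.TTheory GRing.Theory Num.Theory.
Import numFieldNormedType.Exports.

Local Open Scope classical_set_scope.
Local Open Scope ring_scope.

Definition measure_rV_display : measure_display.
Proof. exact. Qed.

Section borel_rV.
Context {R : realType} (n : nat).

(* The Borel sigma-algebra of R^n, generated by the coordinate maps. *)
Definition rV_cylinders : set (set 'rV[R]_n) :=
  [set A | exists (i : 'I_n) (B : set R),
    measurable B /\ A = (fun x : 'rV[R]_n => x ord0 i) @^-1` B].

Let rV_set0 : <<s rV_cylinders >> set0.
Proof. exact: sigma_algebra0. Qed.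

Let rV_setC A : <<s rV_cylinders >> A -> <<s rV_cylinders >> (~` A).
Proof. exact: sigma_algebraC. Qed.

Let rV_bigcup (F : _^nat) : (forall i, <<s rV_cylinders >> (F i)) ->
  <<s rV_cylinders >> (\bigcup_i (F i)).
Proof. exact: sigma_algebra_bigcup. Qed.

HB.instance Definition _ := @isMeasurable.Build measure_rV_display
  'rV[R]_n <<s rV_cylinders >> rV_set0 rV_setC rV_bigcup.

Lemma measurable_coord (i : 'I_n) :
  measurable_fun setT (fun x : 'rV[R]_n => x ord0 i).
Proof.
move=> _ Y mY; rewrite setTI; apply: sub_sigma_algebra.
by exists i, Y.
Qed.

Lemma measurable_fun_rV d (T : measurableType d) (f : T -> 'rV[R]_n) :
  (forall i, measurable_fun setT (fun t => f t ord0 i)) ->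
  measurable_fun setT f.
Proof.
move=> mf _ Y mY; rewrite setTI.
have : <<s rV_cylinders >> `<=` [set A | measurable (f @^-1` A)].
  apply: smallest_sub.
    split => /=.
    - by rewrite preimage_set0; exact: measurable0.
    - by move=> A /= mA; rewrite setTD preimage_setC; exact: measurableC.
    - by move=> F /= mF; rewrite preimage_bigcup; exact: bigcup_measurable.
  by move=> _ [i [B [mB ->]]] /=; rewrite -[X in measurable X]setTI; exact: mf.
exact.
Qed.

End borel_rV.

Definition consrV {R : realType} (n : nat) (p : R * 'rV[R]_n) : 'rV[R]_n.+1 :=
  row_mx (p.1)%:M p.2.


Lemma consrV_ord0 (R : realType) n (p : R * 'rV[R]_n) :
  consrV p ord0 ord0 = p.1.
Proof.
rewrite /consrV (_ : ord0 = lshift n (ord0 : 'I_1)); last exact: val_inj.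
by rewrite (row_mxEl p.1%:M p.2) mxE eqxx mulr1n.
Qed.

Lemma consrV_lift (R : realType) n (p : R * 'rV[R]_n) (i : 'I_n) :
  consrV p ord0 (lift ord0 i) = p.2 ord0 i.
Proof.
rewrite /consrV (_ : lift ord0 i = rshift 1 i); last exact: val_inj.
by rewrite (row_mxEr p.1%:M p.2).
Qed.

Lemma measurable_consrV (R : realType) n :
  measurable_fun setT (@consrV R n : measurableTypeR R * 'rV[R]_n -> _).
Proof.
apply: measurable_fun_rV => i; case: (unliftP ord0 i) => [j|] ->.
  under eq_fun do rewrite consrV_lift.
  exact: (measurableT_comp (measurable_coord j) measurable_snd).
under eq_fun do rewrite consrV_ord0.
exact: measurable_fst.
Qed.

Lemma consrV_bij (R : realType) n (x : 'rV[R]_n.+1) :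
  consrV (x ord0 ord0, \row_i x ord0 (lift ord0 i)) = x.
Proof.
apply/rowP => i; case: (unliftP ord0 i) => [j|] ->.
  by rewrite consrV_lift mxE.
by rewrite consrV_ord0.
Qed.

Section borel_lebesgue_step.
Context {R : realType} (n : nat).
Variable m : {sigma_finite_measure set 'rV[R]_n -> \bar R}.
Local Open Scope ereal_scope.

Definition borel_lebesgue_step : set 'rV[R]_n.+1 -> \bar R :=
  pushforward (@lebesgue_measure R \x m) (@consrV R n).

Let step0 : borel_lebesgue_step set0 = 0.
Proof. by rewrite /borel_lebesgue_step /pushforward preimage_set0 measure0. Qed.

Let step_ge0 A : 0 <= borel_lebesgue_step A.
Proof. by rewrite /borel_lebesgue_step /pushforward; exact: measure_ge0. Qed.

Let step_sigma_additive : semi_sigma_additive borel_lebesgue_step.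
Proof.
move=> F mF tF mUF; rewrite /borel_lebesgue_step /pushforward preimage_bigcup.
have mc A : measurable A -> measurable (@consrV R n @^-1` A).
  by move=> mA; rewrite -[X in measurable X]setTI; exact: measurable_consrV.
apply: measure_semi_sigma_additive.
- by move=> k; exact: mc.
- apply/trivIsetP => /= i j _ _ ij; rewrite -preimage_setI.
  by move/trivIsetP : tF => /(_ _ _ _ _ ij) ->//; rewrite preimage_set0.
- by rewrite -preimage_bigcup; exact: mc.
Qed.

HB.instance Definition _ := isMeasure.Build _ _ _ borel_lebesgue_step
  step0 step_ge0 step_sigma_additive.

Let step_sigma_finite : sigma_finite setT borel_lebesgue_step.
Proof.
pose unc (x : 'rV[R]_n.+1) : measurableTypeR R * 'rV[R]_n :=
  (x ord0 ord0, \row_i x ord0 (lift ord0 i)).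
have munc : measurable_fun setT unc.
  apply: measurable_fun_pair; first exact: measurable_coord.
  apply: measurable_fun_rV => i.
  by under eq_fun do rewrite mxE; exact: measurable_coord.
have /sigma_finiteP[F [TF ndF Foo]] := sigma_finiteT (@lebesgue_measure R).
have /sigma_finiteP[G [TG ndG Goo]] := sigma_finiteT m.
exists (fun k => unc @^-1` (F k `*` G k)).
  rewrite -preimage_bigcup (_ : \bigcup_i _ = setT) ?preimage_setT//.
  apply/seteqP; split => // -[x y] _.
  have [i _ Fx] : (\bigcup_i F i) x by rewrite -TF.
  have [j _ Gy] : (\bigcup_i G i) y by rewrite -TG.
  exists (maxn i j) => //; split => /=.
    by move: x Fx; exact/subsetPset/ndF/leq_maxl.
  by move: y Gy; exact/subsetPset/ndG/leq_maxr.
move=> k; have [mF Fk] := Foo k; have [mG Gk] := Goo k; split.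
  by rewrite -[X in measurable X]setTI; apply: munc => //; exact: measurableX.
rewrite /borel_lebesgue_step /pushforward.
rewrite (_ : _ @^-1` _ = F k `*` G k).
  by rewrite product_measure1E// lte_mul_pinfty// ge0_fin_numE.
by apply/seteqP; split=> -[a b] /=; rewrite /unc consrV_ord0 (_ : \row_i _ = b)//;
  apply/rowP => i; rewrite mxE consrV_lift.
Qed.

HB.instance Definition _ := Measure_isSigmaFinite.Build _ _ _
  borel_lebesgue_step step_sigma_finite.

End borel_lebesgue_step.

(* Lebesgue measure on the Borel sets of R^n, as an n-fold product of the
   one-dimensional one. *)
Fixpoint borel_lebesgue {R : realType} (n : nat) :
    {sigma_finite_measure set 'rV[R]_n -> \bar R} :=
  match n with
  | 0 => \d_(0 : 'rV[R]_0)
  | n'.+1 => borel_lebesgue_step (borel_lebesgue n')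
  end.

Lemma borel_lebesgue_box (R : realType) n (a b : 'I_n -> R) :
  (forall i, a i <= b i) ->
  borel_lebesgue n [set x : 'rV[R]_n | forall i, a i <= x ord0 i <= b i] =
  (\prod_(i < n) (b i - a i))%:E.
Proof.
elim: n a b => [|n IHn] a b ab.
  rewrite big_ord0 /= diracE mem_set//; by move=> [].
rewrite big_ord_recl EFinM /= /borel_lebesgue_step /pushforward.
rewrite (_ : _ @^-1` _ = `[a ord0, b ord0]%classic `*`
    [set x : 'rV[R]_n |
      forall i, a (lift ord0 i) <= x ord0 i <= b (lift ord0 i)]); last first.
  apply/seteqP; split=> -[u v] /=.
    move=> H; split; first by have := H ord0; rewrite consrV_ord0 in_itv.
    by move=> i; have := H (lift ord0 i); rewrite consrV_lift.
  move=> [] + H i; rewrite in_itv /= => H0.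
  case: (unliftP ord0 i) => [j|] ->; first by rewrite consrV_lift.
  by rewrite consrV_ord0.
rewrite product_measure1E//=; last first.
  rewrite (_ : mkset _ = \bigcap_i [set x : 'rV[R]_n |
      a (lift ord0 i) <= x ord0 i <= b (lift ord0 i)]); last first.
    by apply/seteqP; split=> [x /= H i _|x /= H i]; exact: H.
  apply: fin_bigcap_measurable => // i _.
  rewrite (_ : mkset _ = setT `&` (fun x : 'rV[R]_n => x ord0 i) @^-1`
      `[a (lift ord0 i), b (lift ord0 i)]%classic); last first.
    by rewrite setTI; apply/seteqP; split=> x /=; rewrite in_itv.
  exact: measurable_coord.
rewrite IHn; last by move=> i; exact: ab.
rewrite lebesgue_measure_itv/= lte_fin; case: ltgtP (ab ord0) => //= -> _.
by rewrite subrr.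
Qed.

Section lebesgue.
Context {R : realType}.
Local Open Scope ereal_scope.

(* Lebesgue measure on R^d, defined on all Lebesgue measurable sets: its domain
   is 'rV[R]_d equipped with the sigma-algebra of Caratheodory measurable sets
   of the outer measure generated by borel_lebesgue d. *)
Definition lebesgue_rV (d : nat) :=
  @completed_measure_extension _ _ _ (@borel_lebesgue R d).
Arguments lebesgue_rV d : clear implicits.

HB.instance Definition _ d := Measure.on (lebesgue_rV d).

Let lebesgue_rV_sigma_finite d : sigma_finite setT (lebesgue_rV d).
Proof. exact/completed_measure_extension_sigma_finite/sigma_finiteT. Qed.

HB.instance Definition _ d := Measure_isSigmaFinite.Build _ _ _
  (lebesgue_rV d) (lebesgue_rV_sigma_finite d).

Definition lebesgue_measurable d (u : 'rV[R]_d -> R) :=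
  measurable_fun [set: caratheodory_type (@borel_lebesgue R d)^*%mu] u.

(* R^d x R^d carries the completion of the product of the Borel measures, i.e.
   Lebesgue measure on R^(2d); the product of the completed sigma-algebras
   is in general strictly smaller. *)
Definition lebesgue_measurable2 d (g : 'rV[R]_d -> 'rV[R]_d -> R) :=
  measurable_fun
    [set: caratheodory_type (@borel_lebesgue R d \x @borel_lebesgue R d)^*%mu]
    (fun p => g p.1 p.2).

End lebesgue.
Arguments lebesgue_rV {R} d.

Section nonlocal.
Context {R : realType} {d : nat}.
Implicit Types (Omega : set 'rV[R]_d) (gamma eta : 'rV[R]_d -> 'rV[R]_d -> R).
Implicit Types u v : 'rV[R]_d -> R.
Local Notation mu := (@lebesgue_rV R d).
Local Open Scope ereal_scope.

(* Extended-real valued: for a Lebesgue measurable integrand, the value is finite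
   exactly when the integral converges absolutely. *)
Definition nonlocal_op gamma u (x : 'rV[R]_d) : \bar R :=
  \int[mu]_y (u x * gamma x y - u y * gamma y x)%:E.

Definition Gamma_hat Omega gamma : set 'rV[R]_d :=
  [set y | ~ Omega y /\ 0 < \int[mu]_(x in Omega) (gamma y x + gamma x y)%:E].

Definition nonlocal_flux Omega gamma u (y : 'rV[R]_d) : \bar R :=
  \int[mu]_(x in Omega) (u y * gamma y x - u x * gamma x y)%:E.

Definition V_norm2 Omega eta v : \bar R :=
  \int[mu]_(x in Omega) (v x ^+ 2)%:E +
  \int[mu]_(x in Omega) \int[mu]_y ((v x - v y) ^+ 2 * eta y x)%:E.

(* The functions themselves rather than their classes modulo a.e. equality on
   Omega `|` [set y | ~ Omega y /\ 0 < \int[mu]_(x in Omega) (eta y x)%:E]: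
   a statement about V_space is about every representative. *)
Definition V_space Omega eta : set ('rV[R]_d -> R) :=
  [set v | lebesgue_measurable v /\ V_norm2 Omega eta v < +oo].

Definition gamma_tilde gamma k (y x : 'rV[R]_d) : R :=
  Num.max (gamma y x) ((gamma x y - gamma y x) ^+ 2 / k y x)%R.

End nonlocal.

(* Main.v *)
(** The flux [F x y = u x * gamma x y - u y * gamma y x] is antisymmetric.  Writing
[F x y = (u x - u y) * gamma y x + u x * (gamma x y - gamma y x)], the
arithmetic-geometric mean inequality bounds [F x y * (v x - v y)] by
[(u x - u y)^2 * G + 2 (v x - v y)^2 * G + u x ^2 * k y x] with
[G = gamma_tilde gamma k y x], which is integrable on [Omega * R^d]; likewise
[F x y * v x] is dominated after integration in [y] by [(\int |F x y|)^2 + v x ^2].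
Fubini's theorem and antisymmetry then give the identity, the points outside
[Omega] and [Gamma_hat] contributing nothing because [F] vanishes there.

The kernels are measurable only for the completion of the product of Borel
measures.  They are Borel off a symmetric null set [N], and Fubini's theorem is
used for functions that are measurable off [N] for the (finer) product of the
completed sigma-algebras. *)

Require Import Defs.
From mathcomp Require Import all_boot all_order all_algebra.
From mathcomp Require Import all_classical all_reals all_analysis.
From mathcomp Require Import unstable measurable_realfun ess_sup_inf ring lra.

Import Order.TTheory GRing.Theory Num.Theory.
Import numFieldNormedType.Exports.

Local Open Scope classical_set_scope.
Local Open Scope ring_scope.

Set Implicit Arguments.
Unset Strict Implicit.

(** * Pointwise domination of the flux times a difference *)

(** Split [a * p - b * q = (a - b) * q + a * (p - q)]. The first part uses [q <= G] and
    [|(a - b) * w| <= (a - b) ^+ 2 + w ^+ 2]; the second is at most the geometric mean of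
    [a ^+ 2 * k] and [w ^+ 2 * G]. Assuming a product bound [k * G] keeps divisions out. *)
Lemma flux_term_bound (R : realFieldType) (a b w p q k G : R) :
  0 <= q -> q <= G -> 0 <= k -> (p - q) ^+ 2 <= k * G ->
  `|(a * p - b * q) * w| <= (a - b) ^+ 2 * G + w ^+ 2 * G + (a ^+ 2 * k + w ^+ 2 * G).
Proof.
move=> q0 qG k0 pqkG; have G0 : 0 <= G by exact: le_trans qG.
rewrite (_ : _ * w = (a - b) * q * w + a * (p - q) * w); last by ring.
apply: le_trans (ler_normD _ _) _; apply: lerD.
  have H : `|(a - b) * w| <= (a - b) ^+ 2 + w ^+ 2.
    have := sqr_ge0 (a - b - w); have := sqr_ge0 (a - b + w).
    have := sqr_ge0 (a - b); have := sqr_ge0 w.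
    by rewrite ler_norml => *; apply/andP; split; lra.
  rewrite mulrAC normrM (ger0_norm q0) -mulrDl.
  by apply: ler_pM.
have Y0 : 0 <= a ^+ 2 * k + w ^+ 2 * G.
  by apply: addr_ge0; apply: mulr_ge0 => //; exact: sqr_ge0.
(* Comparing squares avoids square roots: for the two summands X and Y on the right, the left square
   is at most XY, and XY is at most the square of X + Y. *)
rewrite -(@ler_pXn2r _ 2)// ?nnegrE//.
rewrite real_normK ?num_real//.
have aw0 : 0 <= (a * w) ^+ 2 by exact: sqr_ge0.
have := ler_wpM2l aw0 pqkG.
have := sqr_ge0 (a ^+ 2 * k - w ^+ 2 * G).
have : 0 <= a ^+ 2 * k * (w ^+ 2 * G).
  by apply: mulr_ge0; apply: mulr_ge0 => //; exact: sqr_ge0.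
lra.
Qed.

Local Open Scope ereal_scope.

(** * Fubini's theorem modulo null sets *)

(** Completeness makes [g] measurable from the a.e. equality alone. This carries iterated integrals
    over to functions that merely agree a.e. with measurable ones. *)
Lemma ae_integrable_integral d (T : measurableType d) (R : realType)
    (mu : {measure set T -> \bar R}) (D : set T) (f g : T -> \bar R) :
  measure_is_complete mu -> measurable D -> ae_eq mu D f g ->
  mu.-integrable D f ->
  mu.-integrable D g /\ \int[mu]_(x in D) f x = \int[mu]_(x in D) g x.
Proof.
move=> cmu mD fg /integrableP[mf foo].
have mg : measurable_fun D g by exact: (ae_measurable_fun cmu fg).
split; last exact: ae_eq_integral.
apply/integrableP; split=> //.
rewrite (_ : \int[mu]_(x in D) _ = \int[mu]_(x in D) `|f x|)//.
apply: ae_eq_integral => //; [exact: measurableT_comp|exact: measurableT_comp|].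
by apply: filterS fg => x /= fg Dx; rewrite fg.
Qed.

Section fubini_modulo_null.
Context d1 d2 (T1 : measurableType d1) (T2 : measurableType d2) (R : realType).
Variables (m1 : {sigma_finite_measure set T1 -> \bar R})
  (m2 : {sigma_finite_measure set T2 -> \bar R}).
Hypotheses (cm1 : measure_is_complete m1) (cm2 : measure_is_complete m2).
Variables (N : set (T1 * T2)).
Hypotheses (mN : measurable N) (N0 : (m1 \x m2) N = 0).

(** The product measure of [N] is the integral of the measures of its sections, and a nonnegative
    function with zero integral vanishes a.e. *)
Lemma ae_xsection0 : {ae m1, forall x, m2 (xsection N x) = 0}.
Proof.
have m0 : measurable_fun setT (m2 \o xsection N) by exact: measurable_fun_xsection.
have := N0; rewrite /product_measure1 => I0.
have : \int[m1]_x `|(m2 \o xsection N) x| = 0.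
  by rewrite -[RHS]I0; apply: eq_integral => x _; rewrite gee0_abs.
by move/(ae_eq_integral_abs m1 measurableT m0); apply: filterS => x /(_ I).
Qed.

(** Nothing is assumed of [f] on [N]: for almost every [x] the sections of [f] and [g] differ only
    inside the null section of [N], and completeness of [m2] passes measurability on. *)
Lemma ae_xsection_eq (f g : T1 * T2 -> \bar R) (B : set T2) : measurable B ->
  measurable_fun setT g -> (forall p, ~ N p -> f p = g p) ->
  {ae m1, forall x, measurable_fun B (fun y => f (x, y)) /\
    ae_eq m2 B (fun y => g (x, y)) (fun y => f (x, y))}.
Proof.
move=> mB mg fg; apply: filterS ae_xsection0 => x Nx0.
have gf : ae_eq m2 B (fun y => g (x, y)) (fun y => f (x, y)).
  exists (xsection N x); split => //; first exact: measurable_xsection.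
  move=> y /= /not_implyP[_ gf]; rewrite /xsection/= inE.
  by apply: contrapT => /fg/esym.
split=> //; apply: (ae_measurable_fun cm2 gf).
by apply: measurable_funTS; exact: measurableT_comp.
Qed.

Lemma ae_integral_xsection_eq (f g : T1 * T2 -> \bar R) (B : set T2) : measurable B ->
  measurable_fun setT g -> (forall p, ~ N p -> f p = g p) ->
  {ae m1, forall x, \int[m2]_(y in B) g (x, y) = \int[m2]_(y in B) f (x, y)}.
Proof.
move=> mB mg fg; apply: filterS (ae_xsection_eq mB mg fg) => x [mf gf].
by apply: ae_eq_integral => //; apply: measurable_funTS; exact: measurableT_comp.
Qed.

Lemma setD_restrict (A : set T1) (B : set T2) (f : T1 * T2 -> \bar R) :
  forall p, ~ N p -> (f \_ (A `*` B)) p = (f \_ ((A `*` B) `\` N)) p.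
Proof.
move=> p Np; rewrite !patchE; congr (if _ then _ else _).
by apply/idP/idP; rewrite !inE => //; case.
Qed.

Lemma restrict_setX (A : set T1) (B : set T2) (f : T1 * T2 -> \bar R) x :
  (fun y => (f \_ (A `*` B)) (x, y)) =
  if x \in A then (fun y => f (x, y)) \_ B else cst 0.
Proof.
apply/funext => y; rewrite !patchE.
have [xA|xA] := boolP (x \in A); last first.
  by case: ifPn => //; rewrite inE => -[/= /mem_set]; rewrite (negbTE xA).
rewrite patchE; congr (if _ then _ else _).
apply/idP/idP => /set_mem h; apply/mem_set; first by case: h.
by split => //; exact: set_mem.
Qed.

Lemma integral_restrict_setX (A : set T1) (B : set T2) (f : T1 * T2 -> \bar R) x :
  \int[m2]_y (f \_ (A `*` B)) (x, y) =
  ((fun x => \int[m2]_(y in B) f (x, y)) \_ A) x.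
Proof.
rewrite patchE restrict_setX; case: ifPn => _; first by rewrite -integral_mkcond.
by rewrite integral0.
Qed.

Lemma measurable_restrict_setXD (A : set T1) (B : set T2) (f : T1 * T2 -> \bar R) :
  measurable A -> measurable B -> measurable_fun (~` N) f ->
  measurable_fun setT (f \_ ((A `*` B) `\` N)).
Proof.
move=> mA mB mf; apply/(measurable_restrictT _ _).1.
  by apply: measurableD => //; exact: measurableX.
by apply: measurable_funS mf; [exact: measurableC|move=> p []].
Qed.

(** A product of complete measures is in general not complete, so [f] need not be jointly
    measurable; its restriction off [N], extended by zero, is. Tonelli's theorem applies to the
    latter, and the iterated integral does not see [N]. *)
Lemma tonelli_setXD (A : set T1) (B : set T2) (f : T1 * T2 -> \bar R) :
  measurable A -> measurable B ->
  measurable_fun (~` N) f -> (forall p, 0 <= f p) ->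
  [/\ {ae m1, forall x, A x -> measurable_fun B (fun y => f (x, y))},
      measurable_fun A (fun x => \int[m2]_(y in B) f (x, y)) &
      \int[m1]_(x in A) \int[m2]_(y in B) f (x, y) =
      \int[m1 \x m2]_(p in (A `*` B) `\` N) f p].
Proof.
move=> mA mB mf f0; pose g := f \_ ((A `*` B) `\` N).
have mg : measurable_fun setT g by exact: measurable_restrict_setXD.
have g0 p : 0 <= g p by rewrite /g patchE; case: ifPn.
have fg p : ~ N p -> (f \_ (A `*` B)) p = g p by exact: setD_restrict.
have sec := ae_xsection_eq measurableT mg fg.
have seci := ae_integral_xsection_eq measurableT mg fg.
have mG : measurable_fun setT (fubini_F m2 g).
  exact: measurable_fun_fubini_tonelli_F.
(* The partial integrals of [f] and [g] agree for almost every [x], so completeness of [m1] yields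
   measurability of the former. *)
have aeG : ae_eq m1 setT (fubini_F m2 g) (fun x => \int[m2]_y (f \_ (A `*` B)) (x, y)).
  by apply: filterS seci => x + _; exact.
have mF := ae_measurable_fun cm1 aeG mG.
have FE : (fun x => \int[m2]_y (f \_ (A `*` B)) (x, y)) =
    (fun x => \int[m2]_(y in B) f (x, y)) \_ A.
  by apply/funext => x; rewrite integral_restrict_setX.
split.
- apply: filterS sec => x [+ _] Ax; rewrite restrict_setX mem_set//.
  by move/(measurable_restrictT _ mB).2.
- by apply/(measurable_restrictT _ mA).2; rewrite -FE.
- rewrite [RHS]integral_mkcond -/g fubini_tonelli1//.
  rewrite [LHS]integral_mkcond -FE; apply: ae_eq_integral => //.
  by apply: filterS aeG => x /(_ I) ->.
Qed.

Lemma integrable_setXD (A : set T1) (B : set T2) (f : T1 * T2 -> \bar R) :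
  measurable A -> measurable B -> measurable_fun (~` N) f ->
  \int[m1]_(x in A) \int[m2]_(y in B) `|f (x, y)| < +oo ->
  (m1 \x m2).-integrable ((A `*` B) `\` N) f.
Proof.
move=> mA mB mf foo; apply/integrableP; split.
  by apply: measurable_funS mf; [exact: measurableC|move=> p []].
have mfa : measurable_fun (~` N) (abse \o f) by exact: measurableT_comp.
have [_ _ <- //] := tonelli_setXD mA mB mfa (fun p => abse_ge0 _).
Qed.

(** The same reduction with integrability in place of a sign: Fubini's theorem holds for the
    function cut off on [N], and completeness brings sections and partial integrals back to [f]. *)
Lemma fubini_setXD1 (A : set T1) (B : set T2) (f : T1 * T2 -> \bar R) :
  measurable A -> measurable B ->
  (m1 \x m2).-integrable ((A `*` B) `\` N) f ->
  [/\ {ae m1, forall x, A x -> m2.-integrable B (fun y => f (x, y))},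
      m1.-integrable A (fun x => \int[m2]_(y in B) f (x, y)) &
      \int[m1]_(x in A) \int[m2]_(y in B) f (x, y) =
      \int[m1 \x m2]_(p in (A `*` B) `\` N) f p].
Proof.
move=> mA mB intf.
have mABN : measurable ((A `*` B) `\` N) by apply: measurableD => //; exact: measurableX.
pose g := f \_ ((A `*` B) `\` N).
have intg : (m1 \x m2).-integrable setT g by apply/(integrable_mkcond _ _).1.
have mg := measurable_int _ intg.
have fg p : ~ N p -> (f \_ (A `*` B)) p = g p by exact: setD_restrict.
have sec := ae_xsection_eq measurableT mg fg.
have seci := ae_integral_xsection_eq measurableT mg fg.
have [iF eF] : m1.-integrable setT (fun x => \int[m2]_y (f \_ (A `*` B)) (x, y)) /\
   \int[m1]_x \int[m2]_y g (x, y) = \int[m1]_x \int[m2]_y (f \_ (A `*` B)) (x, y).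
  apply: ae_integrable_integral => //; last exact: (integrable_fubini_F intg).
  by apply: filterS seci => x ->.
split.
- apply: filterS2 sec (ae_integrable1 intg) => x [_ gf] ig Ax.
  apply/(integrable_mkcond _ _).2 => //.
  have [+ _] := ae_integrable_integral cm2 measurableT gf ig.
  by rewrite restrict_setX mem_set.
- apply/(integrable_mkcond _ _).2 => //; apply: eq_integrable iF => // x _.
  exact: integral_restrict_setX.
- rewrite [RHS]integral_mkcond -/g -(integral12_prod_meas1 intg) [RHS]eF.
  rewrite [LHS]integral_mkcond; apply: eq_integral => x _.
  by rewrite integral_restrict_setX.
Qed.

End fubini_modulo_null.

(** * Integration by parts for an antisymmetric kernel *)

Lemma integrable_swap d1 d2 (T1 : measurableType d1) (T2 : measurableType d2)
    (R : realType) (m1 : {sigma_finite_measure set T1 -> \bar R})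
    (m2 : {sigma_finite_measure set T2 -> \bar R}) (f : T1 * T2 -> \bar R) :
  (m1 \x m2).-integrable setT f ->
  (m2 \x m1).-integrable setT (f \o swap) /\
  \int[m2 \x m1]_p (f \o swap) p = \int[m1 \x m2]_p f p.
Proof.
move=> intf; have mf := measurable_int _ intf.
have intfs : (m2 \x m1).-integrable setT (f \o swap).
  apply/integrable12ltyP; last exact/(integrable21ltyP m1 m2 mf).
  by apply: measurableT_comp => //; exact: measurable_swap.
by split=> //; rewrite -integral12_prod_meas1// -integral21_prod_meas1.
Qed.

Section antisymmetric_kernel.
Context d (T : measurableType d) (R : realType).
Variable mu : {sigma_finite_measure set T -> \bar R}.
Hypothesis cmu : measure_is_complete mu.
Variable N : set (T * T).
Hypotheses (mN : measurable N) (N0 : (mu \x mu) N = 0).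
Hypothesis symN : forall x y, N (x, y) -> N (y, x).

Let mXD A B : measurable A -> measurable B -> measurable ((A `*` B) `\` N).
Proof. by move=> mA mB; apply: measurableD => //; exact: measurableX. Qed.

(** Symmetry of [N] makes the reflection of the first domain equal to the second. *)
Lemma swap_setXD (A B : set T) (f : T * T -> \bar R) :
  measurable A -> measurable B ->
  (mu \x mu).-integrable ((A `*` B) `\` N) f ->
  (mu \x mu).-integrable ((B `*` A) `\` N) (f \o swap) /\
  \int[mu \x mu]_(p in (B `*` A) `\` N) (f \o swap) p =
  \int[mu \x mu]_(p in (A `*` B) `\` N) f p.
Proof.
move=> mA mB /(integrable_mkcond _ (mXD mA mB)).1 /integrable_swap.
rewrite (_ : (f \_ ((A `*` B) `\` N)) \o swap = (f \o swap) \_ ((B `*` A) `\` N)).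
  by rewrite -2!integral_mkcond => -[/(integrable_mkcond _ (mXD mB mA)).2].
apply/funext => -[x y] /=; rewrite !patchE; congr (if _ then _ else _).
by apply/idP/idP => /set_mem/= [[? ?] /= nN]; apply/mem_set; split=> // /symN.
Qed.

Variables (Omega Gamma : set T) (F : T -> T -> R) (v : T -> R).
Hypotheses (mOmega : measurable Omega) (mGamma : measurable Gamma).
Hypothesis OmegaGamma : Gamma `<=` ~` Omega.
Hypothesis Fanti : forall x y, F y x = (- F x y)%R.
Hypothesis Fvanish : {ae mu, forall y, ~ Omega y -> ~ Gamma y ->
  {ae mu, forall x, Omega x -> F x y = 0%R}}.
Hypothesis intF :
  (mu \x mu).-integrable ((Omega `*` setT) `\` N) (fun p => (F p.1 p.2)%:E).

Let f1 (p : T * T) := (F p.1 p.2 * v p.1)%:E.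
Let f2 (p : T * T) := (F p.1 p.2 * (v p.1 - v p.2))%:E.

Hypothesis intf1 : (mu \x mu).-integrable ((Omega `*` setT) `\` N) f1.
Hypothesis intf2 : (mu \x mu).-integrable ((Omega `*` setT) `\` N) f2.

Let intA A (f : T * T -> \bar R) : measurable A ->
  (mu \x mu).-integrable ((Omega `*` setT) `\` N) f ->
  (mu \x mu).-integrable ((Omega `*` A) `\` N) f.
Proof.
move=> mA; apply: integrableS; [exact: mXD|exact: mXD|].
by move=> p [[? _] ?]; split.
Qed.

(** Antisymmetry turns [- F x y * v y] into [F y x * v y], the value of [f1] at the swapped
    point. *)
Let f2E p : f2 p = (f1 \+ (f1 \o swap)) p.
Proof. by rewrite /f1/f2/= -EFinD (Fanti p.1); congr EFin; ring. Qed.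

(** Obtained as the difference of [f2] and [f1], hence without any direct control of [v] outside
    [Omega]. *)
Let intf1s A : measurable A ->
  (mu \x mu).-integrable ((Omega `*` A) `\` N) (f1 \o swap).
Proof.
move=> mA; have := integrableB (mXD mOmega mA) (intA mA intf2) (intA mA intf1).
apply: eq_integrable => [|p _]; first exact: mXD.
by rewrite f2E /=; rewrite addeAC subee// add0e.
Qed.

Let int_f2 A : measurable A ->
  \int[mu]_(x in Omega) \int[mu]_(y in A) f2 (x, y) =
  \int[mu \x mu]_(p in (Omega `*` A) `\` N) f1 p +
  \int[mu \x mu]_(p in (Omega `*` A) `\` N) (f1 \o swap) p.
Proof.
move=> mA.
have [_ _ ->] := fubini_setXD1 cmu cmu mN N0 mOmega mA (intA mA intf2).
rewrite -integralD; [|exact: mXD|exact: intA|exact: intf1s].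
by apply: eq_integral => p _; exact: f2E.
Qed.

(** Decompose [f2] into [f1] and its swap. Over [Omega] times [Omega] both parts have the same
    integral; over [Omega] times [Gamma] the swapped part is the flux term. The remaining pieces of
    [f1] make up its integral over [Omega] times the whole space, since the flux vanishes outside
    [Omega] and [Gamma]. *)
Lemma flux_integration_by_parts :
  [/\ mu.-integrable Omega (fun x => (\int[mu]_y (F x y)%:E) * (v x)%:E),
      mu.-integrable Gamma (fun y => (\int[mu]_(x in Omega) (F y x)%:E) * (v y)%:E),
      mu.-integrable Omega (fun x => \int[mu]_(y in Omega) f2 (x, y)),
      mu.-integrable Omega (fun x => \int[mu]_(y in Gamma) f2 (x, y)) &
      \int[mu]_(x in Omega) ((\int[mu]_y (F x y)%:E) * (v x)%:E) +
      \int[mu]_(y in Gamma) ((\int[mu]_(x in Omega) (F y x)%:E) * (v y)%:E) =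
      (2^-1)%:E * \int[mu]_(x in Omega) \int[mu]_(y in Omega) f2 (x, y) +
      \int[mu]_(x in Omega) \int[mu]_(y in Gamma) f2 (x, y)].
Proof.
have fub A f (mA : measurable A) intf :=
  fubini_setXD1 cmu cmu mN N0 mOmega mA (@intA A f mA intf).
have [aeF _ _] := fub _ _ measurableT intF.
have [_ if1 ef1] := fub _ _ measurableT intf1.
have [iL eL] : mu.-integrable Omega (fun x => (\int[mu]_y (F x y)%:E) * (v x)%:E) /\
    \int[mu]_(x in Omega) \int[mu]_y f1 (x, y) =
    \int[mu]_(x in Omega) ((\int[mu]_y (F x y)%:E) * (v x)%:E).
  (* For almost every [x] the function [F x] is integrable, so [v x] comes out of the inner
     integral. *)
  apply: ae_integrable_integral if1 => //; apply: filterS aeF => x iFx Ox.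
  by rewrite /f1/=; under eq_integral do rewrite EFinM; rewrite integralZr//; exact: iFx.
have [is1 es1] := swap_setXD mOmega mGamma (intA mGamma intf1).
have [isF _] := swap_setXD mOmega mGamma (intA mGamma intF).
have [aesF _ _] := fubini_setXD1 cmu cmu mN N0 mGamma mOmega isF.
have iF y : Gamma y -> mu.-integrable Omega (fun x => (F x y)%:E) ->
    mu.-integrable Omega (fun x => (F y x)%:E).
  move=> _ iFy; have := integrableN iFy; apply: eq_integrable => // x _ /=.
  by rewrite (Fanti x y).
have [is2 es2] := swap_setXD mOmega mGamma (intf1s mGamma).
have [_ if2 ef2] := fubini_setXD1 cmu cmu mN N0 mGamma mOmega is2.
have [iN eN] : mu.-integrable Gamma
      (fun y => (\int[mu]_(x in Omega) (F y x)%:E) * (v y)%:E) /\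
    \int[mu]_(y in Gamma) \int[mu]_(x in Omega) f1 (y, x) =
    \int[mu]_(y in Gamma) ((\int[mu]_(x in Omega) (F y x)%:E) * (v y)%:E).
  apply: ae_integrable_integral if2 => //; apply: filterS aesF => y iFy Gy.
  rewrite /f1/=; under eq_integral do rewrite EFinM.
  by rewrite integralZr//; exact: iF (iFy Gy).
split => //.
- by have [] := fub _ _ mOmega intf2.
- by have [] := fub _ _ mGamma intf2.
rewrite -eL -eN ef1 ef2 es2 !int_f2//.
(* The swap preserves [Omega] times [Omega]; this is the source of the factor 1/2. *)
have [_ ->] := swap_setXD mOmega mOmega (intA mOmega intf1).
(* The variables are swapped before using [Fvanish], which fixes the outer point [y] and then
   concerns almost every [x] in [Omega]. *)
pose Z := ~` (Omega `|` Gamma).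
have mZ : measurable Z by apply: measurableC; exact: measurableU.
have Z0 : \int[mu \x mu]_(p in (Omega `*` Z) `\` N) f1 p = 0.
  have [isZ <-] := swap_setXD mOmega mZ (intA mZ intf1).
  have [_ ifZ <-] := fubini_setXD1 cmu cmu mN N0 mZ mOmega isZ.
  have aeZ : ae_eq mu Z (cst 0) (fun y => \int[mu]_(x in Omega) (f1 \o swap) (y, x)).
    apply: filterS Fvanish => y Fy Zy.
    have aeO : ae_eq mu Omega (cst 0) (fun x => (f1 \o swap) (y, x)).
      apply: filterS (Fy (fun Oy => Zy (or_introl Oy)) (fun Gy => Zy (or_intror Gy))).
      by move=> x Fxy Ox; rewrite /f1/= Fxy// mul0r.
    have [_ <-] := ae_integrable_integral cmu mOmega aeO (integrable0 mu Omega).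
    by rewrite integral0.
  have [_ <-] := ae_integrable_integral cmu mZ aeZ (integrable0 mu Z).
  by rewrite integral0.
have disj A B : A `&` B = set0 -> [disjoint (Omega `*` A) `\` N & (Omega `*` B) `\` N].
  move=> AB0; apply/eqP; apply/seteqP; split=> // p [[[_ Ap] _] [[_ Bp] _]].
  have : (A `&` B) p.2 by split.
  by rewrite AB0.
have UXD A B : (Omega `*` (A `|` B)) `\` N = (Omega `*` A) `\` N `|` (Omega `*` B) `\` N.
  apply/seteqP; split=> [p [[Op [Ap|Bp]] nN]|p [[[Op Ap] nN]|[[Op Bp] nN]]].
  - by left.
  - by right.
  - by split => //; split => //; left.
  - by split => //; split => //; right.
have split3 : \int[mu \x mu]_(p in (Omega `*` setT) `\` N) f1 p =
    \int[mu \x mu]_(p in (Omega `*` Omega) `\` N) f1 p +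
    \int[mu \x mu]_(p in (Omega `*` Gamma) `\` N) f1 p.
  have mf1 := measurable_int _ intf1.
  have mOG : measurable (Omega `|` Gamma) by exact: measurableU.
  rewrite -(setUv (Omega `|` Gamma)) UXD integral_setU; last 4 first.
  - exact: mXD.
  - exact: mXD.
  - by rewrite -UXD setUv.
  - by apply: disj; rewrite setICr.
  rewrite Z0 adde0 UXD integral_setU//; [exact: mXD|exact: mXD| |].
  - apply: measurable_funS mf1; first exact: mXD.
    by rewrite -UXD => p [[? _] ?].
  - by apply: disj; apply/seteqP; split=> // x [Ox /OmegaGamma].
rewrite split3.
(* Finiteness moves the identity [2^-1 * (a + a) = a] to the reals. *)
have fO := integrable_fin_num (mXD mOmega mOmega) (intA mOmega intf1).
rewrite -(fineK fO); set a := fine _.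
rewrite -EFinD -EFinM (_ : (2^-1 * (a + a) = a)%R); last by field.
by rewrite -addeA.
Qed.

End antisymmetric_kernel.

(** * Integrability of the flux terms on [Omega] times the whole space *)

Section nonlocal_flux_integrability.
Context d (T : measurableType d) (R : realType).
Variable mu : {sigma_finite_measure set T -> \bar R}.
Hypothesis cmu : measure_is_complete mu.
Variable N : set (T * T).
Hypotheses (mN : measurable N) (N0 : (mu \x mu) N = 0).
Hypothesis symN : forall x y, N (x, y) -> N (y, x).
Variables (Omega : set T) (mOmega : measurable Omega).

Let mXD A B : measurable A -> measurable B -> measurable ((A `*` B) `\` N).
Proof. by move=> mA mB; apply: measurableD => //; exact: measurableX. Qed.

Lemma measurable_fun_setC_swap (h : T -> T -> R) :
  measurable_fun (~` N) (fun p => h p.1 p.2) ->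
  measurable_fun (~` N) (fun p => h p.2 p.1).
Proof.
move=> mh; apply: (measurable_comp (F := ~` N) (g := swap) _ _ mh).
- exact: measurableC.
- by move=> _ [[x y] /= nN <-] /symN.
- by apply: measurable_funTS; exact: measurable_swap.
Qed.

(** Integrating in [y] first gives [I * |v x|], where [I] is the integral of [|F x y|]; this is at
    most [I ^+ 2 + v x ^+ 2]. *)
Lemma integrable_flux_mul (F : T -> T -> R) (v : T -> R) :
  measurable_fun (~` N) (fun p => F p.1 p.2) -> measurable_fun setT v ->
  \int[mu]_(x in Omega) (\int[mu]_y `|F x y|%:E) ^+ 2 < +oo ->
  \int[mu]_(x in Omega) (v x ^+ 2)%:E < +oo ->
  (mu \x mu).-integrable ((Omega `*` setT) `\` N) (fun p => (F p.1 p.2 * v p.1)%:E).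
Proof.
move=> mF mv F2 v2.
have mv1 : measurable_fun (~` N) (fun p : T * T => v p.1).
  by apply: measurable_funTS; exact: measurableT_comp.
have mFv : measurable_fun (~` N) (fun p => (F p.1 p.2 * v p.1)%:E).
  by apply/measurable_EFinP; exact: measurable_funM.
have mFa : measurable_fun (~` N) (fun p => `|F p.1 p.2|%:E).
  by apply/measurable_EFinP; exact: measurableT_comp.
have [aeF mI _] := tonelli_setXD cmu cmu mN N0 mOmega measurableT mFa
  (fun p => normr_ge0 _).
have [_ mIv _] := tonelli_setXD cmu cmu mN N0 mOmega measurableT
  (measurableT_comp (@abse_measurable R setT) mFv) (fun p => abse_ge0 _).
apply: (integrable_setXD cmu cmu mN N0 mOmega measurableT mFv) => //=.
have mI2 : measurable_fun Omega (fun x => (\int[mu]_y `|F x y|%:E) ^+ 2).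
  exact: (emeasurable_funM mI mI).
have mv2 : measurable_fun Omega (fun x => (v x ^+ 2)%:E).
  apply/measurable_EFinP; apply: measurable_funTS.
  exact: measurable_funX.
apply: (@le_lt_trans _ _ (\int[mu]_(x in Omega)
    ((\int[mu]_y `|F x y|%:E) ^+ 2 + (v x ^+ 2)%:E))).
  apply: ae_ge0_le_integral => //.
  - by move=> x _; apply: integral_ge0.
  - by move=> x _; rewrite adde_ge0 ?sqre_ge0// lee_fin sqr_ge0.
  - exact: emeasurable_funD.
  apply: filterS aeF => x /= mFx Ox.
  under eq_integral do rewrite normrM EFinM.
  rewrite ge0_integralZr//; last exact: mFx.
  have : 0 <= \int[mu]_y `|F x y|%:E by exact: integral_ge0.
  (* The inner integral may be infinite at some points; there the right-hand side is infinite
     too. *)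
  case: (\int[mu]_y `|F x y|%:E) => [r| |] //; last first.
    by move=> _; rewrite mulyy addye// leey.
  rewrite lee_fin => r0.
  rewrite -!EFinM -EFinD lee_fin -(real_normK (num_real (v x))).
  have := sqr_ge0 (r - `|v x|)%R; have := sqr_ge0 r; have := sqr_ge0 `|v x|%R.
  lra.
rewrite ge0_integralD//; first exact: lte_add_pinfty.
- by move=> x _; exact: sqre_ge0.
- by move=> x _; rewrite lee_fin sqr_ge0.
Qed.

Lemma integrable_sqr_diff_mul (G : T -> T -> R) (v : T -> R) :
  measurable_fun (~` N) (fun p => G p.1 p.2) -> measurable_fun setT v ->
  (forall x y, (0 <= G x y)%R) ->
  \int[mu]_(x in Omega) \int[mu]_y ((v x - v y) ^+ 2 * G x y)%:E < +oo ->
  (mu \x mu).-integrable ((Omega `*` setT) `\` N)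
    (fun p => ((v p.1 - v p.2) ^+ 2 * G p.1 p.2)%:E).
Proof.
move=> mG mv G0 foo; apply: (integrable_setXD cmu cmu) => //.
  apply/measurable_EFinP; apply: measurable_funM => //.
  apply: measurable_funTS; apply: measurable_funX.
  by apply: measurable_funB; exact: measurableT_comp.
apply: le_lt_trans foo; rewrite le_eqVlt; apply/orP; left; apply/eqP.
apply: eq_integral => x _; apply: eq_integral => y _ /=.
by rewrite ger0_norm// mulr_ge0// sqr_ge0.
Qed.

(** Integrating in [y] first leaves at most a constant times [u x ^+ 2]. *)
Lemma integrable_sqr_mul_kernel (k : T -> T -> R) (u : T -> R) (M : R) :
  measurable_fun (~` N) (fun p => k p.1 p.2) -> measurable_fun setT u ->
  (forall x y, (0 <= k x y)%R) ->
  {ae mu, forall x, Omega x -> \int[mu]_y (k x y)%:E <= M%:E} ->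
  \int[mu]_(x in Omega) (u x ^+ 2)%:E < +oo ->
  (mu \x mu).-integrable ((Omega `*` setT) `\` N)
    (fun p => (u p.1 ^+ 2 * k p.1 p.2)%:E).
Proof.
move=> mk meas_u k0 kM foo.
have mk' : measurable_fun (~` N) (fun p => (k p.1 p.2)%:E) by apply/measurable_EFinP.
have muk : measurable_fun (~` N) (fun p => (u p.1 ^+ 2 * k p.1 p.2)%:E).
  apply/measurable_EFinP; apply: measurable_funM => //.
  apply: measurable_funTS; apply: measurable_funX.
  exact: measurableT_comp.
have [aek _ _] := tonelli_setXD cmu cmu mN N0 mOmega measurableT mk'
  (fun p => k0 _ _).
have [_ mI _] := tonelli_setXD cmu cmu mN N0 mOmega measurableT
  (measurableT_comp (@abse_measurable R setT) muk) (fun p => abse_ge0 _).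
have mu2 : measurable_fun Omega (fun x => (u x ^+ 2)%:E).
  by apply/measurable_EFinP; apply: measurable_funTS; exact: measurable_funX.
apply: (integrable_setXD cmu cmu mN N0 mOmega measurableT muk) => //=.
(* No sign is assumed of [M], hence the maximum with 0. *)
apply: (@le_lt_trans _ _ (\int[mu]_(x in Omega) ((u x ^+ 2)%:E * (Num.max M 0)%:E))).
  apply: ae_ge0_le_integral => //.
  - by move=> x _; apply: integral_ge0.
  - by move=> x _; rewrite -EFinM lee_fin mulr_ge0 ?sqr_ge0// le_max lexx orbT.
  - by apply: emeasurable_funM => //; exact: measurable_cst.
  apply: filterS2 aek kM => x /= mkx kM Ox.
  rewrite (_ : \int[mu]_y _ = \int[mu]_y ((u x ^+ 2)%:E * (k x y)%:E)); last first.
    apply: eq_integral => y _; rewrite -EFinM ger0_norm//.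
    by rewrite mulr_ge0// sqr_ge0.
  rewrite (ge0_integralZl mu measurableT (mkx Ox)); last 2 first.
  - by move=> y _; rewrite lee_fin.
  - by rewrite lee_fin sqr_ge0.
  apply: lee_wpmul2l; first by rewrite lee_fin sqr_ge0.
  by apply: le_trans (kM Ox) _; rewrite lee_fin le_max lexx.
rewrite ge0_integralZr//; last by rewrite lee_fin le_max lexx orbT.
have u20 : 0 <= \int[mu]_(x in Omega) (u x ^+ 2)%:E.
  by apply: integral_ge0 => x _; rewrite lee_fin sqr_ge0.
by apply: lte_mul_pinfty; rewrite ?ge0_fin_numE ?ltry.
by move=> x _; rewrite lee_fin sqr_ge0.
Qed.

(** [flux_term_bound] with [p = gamma x y], [q = gamma y x] and [w = v x - v y] dominates the
    integrand by squared differences of [u] and [v] weighted by [G], plus [u x ^+ 2 * k x y]. *)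
Lemma integrable_flux_mul_diff (gamma k G : T -> T -> R) (u v : T -> R) (M : R) :
  measurable_fun (~` N) (fun p => gamma p.1 p.2) ->
  measurable_fun (~` N) (fun p => k p.1 p.2) ->
  measurable_fun (~` N) (fun p => G p.1 p.2) ->
  measurable_fun setT u -> measurable_fun setT v ->
  (forall x y, 0 <= gamma x y)%R -> (forall x y, 0 <= k x y)%R ->
  (forall x y, gamma y x <= G x y)%R ->
  (forall x y, (gamma x y - gamma y x) ^+ 2 <= k x y * G x y)%R ->
  {ae mu, forall x, Omega x -> \int[mu]_y (k x y)%:E <= M%:E} ->
  \int[mu]_(x in Omega) (u x ^+ 2)%:E < +oo ->
  \int[mu]_(x in Omega) \int[mu]_y ((u x - u y) ^+ 2 * G x y)%:E < +oo ->
  \int[mu]_(x in Omega) \int[mu]_y ((v x - v y) ^+ 2 * G x y)%:E < +oo ->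
  (mu \x mu).-integrable ((Omega `*` setT) `\` N)
    (fun p => ((u p.1 * gamma p.1 p.2 - u p.2 * gamma p.2 p.1)
                * (v p.1 - v p.2))%:E).
Proof.
move=> mg mk mG meas_u mv g0 k0 gG gkG kM u2 uG vG.
have G0 x y : (0 <= G x y)%R by exact: le_trans (gG x y).
have iu := integrable_sqr_diff_mul mG meas_u G0 uG.
have iv := integrable_sqr_diff_mul mG mv G0 vG.
have ik := integrable_sqr_mul_kernel mk meas_u k0 kM u2.
have mD := mXD mOmega measurableT.
have iS := integrableD mD (integrableD mD iu iv) (integrableD mD ik iv).
apply: (le_integrable mD _ _ iS).
  apply/measurable_EFinP.
  have m1 (w : T -> R) : measurable_fun setT w ->
      measurable_fun (~` N) (fun p : T * T => w p.1).
    by move=> mw; apply: measurable_funTS; exact: measurableT_comp.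
  have m2 (w : T -> R) : measurable_fun setT w ->
      measurable_fun (~` N) (fun p : T * T => w p.2).
    by move=> mw; apply: measurable_funTS; exact: measurableT_comp.
  have mgs := measurable_fun_setC_swap mg.
  apply: (measurable_funS (E := ~` N)); [exact: measurableC|by move=> p []|].
  apply: measurable_funM; apply: measurable_funB.
  - by apply: measurable_funM => //; exact: m1.
  - by apply: measurable_funM => //; exact: m2.
  - exact: m1.
  - exact: m2.
move=> p _ /=; rewrite lee_fin.
apply: le_trans (ler_norm _).
exact: flux_term_bound.
Qed.

End nonlocal_flux_integrability.

(** * The nonlocal identity over a complete sigma-finite measure *)

Section nonlocal_integration_by_parts.
Context d (T : measurableType d) (R : realType).
Variable mu : {sigma_finite_measure set T -> \bar R}.
Hypothesis cmu : measure_is_complete mu.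
Variable N : set (T * T).
Hypotheses (mN : measurable N) (N0 : (mu \x mu) N = 0).
Hypothesis symN : forall x y, N (x, y) -> N (y, x).
Variables (Omega : set T) (gamma : T -> T -> R).
Hypothesis mOmega : measurable Omega.
Hypothesis mgamma : measurable_fun (~` N) (fun p => gamma p.1 p.2).
Hypothesis gamma0 : forall x y, (0 <= gamma x y)%R.

(** The set [Gamma_hat], for a general measure [mu]. *)
Let Gamma := [set y | ~ Omega y /\
  0 < \int[mu]_(x in Omega) (gamma y x + gamma x y)%:E].

Let gamma_sym0 y : 0 <= \int[mu]_(x in Omega) (gamma y x + gamma x y)%:E.
Proof. by apply: integral_ge0 => x _; rewrite lee_fin addr_ge0. Qed.

Let mgamma_sym :
  measurable_fun (~` N) (fun p => (gamma p.1 p.2 + gamma p.2 p.1)%:E).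
Proof.
apply/measurable_EFinP; apply: measurable_funD => //.
exact: measurable_fun_setC_swap.
Qed.

Lemma measurable_Gamma : measurable Gamma.
Proof.
have [_ mI _] := tonelli_setXD cmu cmu mN N0 measurableT mOmega mgamma_sym
  (fun p => addr_ge0 (gamma0 _ _) (gamma0 _ _)).
rewrite (_ : Gamma = ~` Omega `&`
    (setT `&` (fun y => \int[mu]_(x in Omega) (gamma y x + gamma x y)%:E)
      @^-1` `]0, +oo])).
  apply: measurableI; first exact: measurableC.
  exact: (mI measurableT _ (emeasurable_itv _)).
rewrite setTI; apply/seteqP; split=> y [nO]; rewrite /preimage/= in_itv/= leey andbT;
  by move=> ?; split.
Qed.

(** For [y] outside both sets the nonnegative function [gamma y x + gamma x y] has zero integral
    over [Omega], so both kernel values vanish for almost every [x]. The exceptional [y] are those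
    whose section is not measurable. *)
Lemma flux_vanish (u : T -> R) :
  {ae mu, forall y, ~ Omega y -> ~ Gamma y -> {ae mu, forall x, Omega x ->
    (u x * gamma x y - u y * gamma y x)%R = 0%R}}.
Proof.
have [aem _ _] := tonelli_setXD cmu cmu mN N0 measurableT mOmega mgamma_sym
  (fun p => addr_ge0 (gamma0 _ _) (gamma0 _ _)).
apply: filterS aem => y /(_ I) /= my nO nG.
have I0 : \int[mu]_(x in Omega) `|(gamma y x + gamma x y)%:E| = 0.
  under eq_integral do rewrite gee0_abs ?lee_fin ?addr_ge0//.
  apply: contrapT => /eqP I0; apply: nG; split => //.
  by rewrite lt_neqAle eq_sym I0 gamma_sym0.
move/(ae_eq_integral_abs mu mOmega my) : I0; apply: filterS => x /= + Ox.
move=> /(_ Ox) [] /eqP; rewrite paddr_eq0// => /andP[/eqP -> /eqP ->].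
by rewrite !mulr0 subrr.
Qed.

Variables (k G : T -> T -> R) (u : T -> R) (M : R).
Hypothesis Omega_fin : mu Omega < +oo.
Hypothesis mk : measurable_fun (~` N) (fun p => k p.1 p.2).
Hypothesis mG : measurable_fun (~` N) (fun p => G p.1 p.2).
Hypothesis k0 : forall x y, (0 <= k x y)%R.
Hypothesis gammaG : forall x y, (gamma y x <= G x y)%R.
Hypothesis gammakG :
  forall x y, ((gamma x y - gamma y x) ^+ 2 <= k x y * G x y)%R.
Hypothesis kM : {ae mu, forall x, Omega x -> \int[mu]_y (k x y)%:E <= M%:E}.
Hypothesis meas_u : measurable_fun setT u.
Hypothesis u2 : \int[mu]_(x in Omega) (u x ^+ 2)%:E < +oo.
Hypothesis uG :
  \int[mu]_(x in Omega) \int[mu]_y ((u x - u y) ^+ 2 * G x y)%:E < +oo.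

Let F x y := (u x * gamma x y - u y * gamma y x)%R.

Hypothesis F2 : \int[mu]_(x in Omega) (\int[mu]_y `|F x y|%:E) ^+ 2 < +oo.

Lemma nonlocal_integration_by_parts (v : T -> R) : measurable_fun setT v ->
  \int[mu]_(x in Omega) (v x ^+ 2)%:E < +oo ->
  \int[mu]_(x in Omega) \int[mu]_y ((v x - v y) ^+ 2 * G x y)%:E < +oo ->
  [/\ mu.-integrable Omega (fun x => (\int[mu]_y (F x y)%:E) * (v x)%:E),
      mu.-integrable Gamma (fun y => (\int[mu]_(x in Omega) (F y x)%:E) * (v y)%:E),
      mu.-integrable Omega
        (fun x => \int[mu]_(y in Omega) (F x y * (v x - v y))%:E),
      mu.-integrable Omega
        (fun x => \int[mu]_(y in Gamma) (F x y * (v x - v y))%:E) &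
      \int[mu]_(x in Omega) ((\int[mu]_y (F x y)%:E) * (v x)%:E) +
      \int[mu]_(y in Gamma) ((\int[mu]_(x in Omega) (F y x)%:E) * (v y)%:E) =
      (2^-1)%:E * \int[mu]_(x in Omega) \int[mu]_(y in Omega)
                    (F x y * (v x - v y))%:E +
      \int[mu]_(x in Omega) \int[mu]_(y in Gamma) (F x y * (v x - v y))%:E].
Proof.
move=> mv v2 vG.
have mF : measurable_fun (~` N) (fun p => F p.1 p.2).
  apply: measurable_funB; apply: measurable_funM => //.
  - by apply: measurable_funTS; exact: measurableT_comp.
  - by apply: measurable_funTS; exact: measurableT_comp.
  - exact: measurable_fun_setC_swap.
have intF : (mu \x mu).-integrable ((Omega `*` setT) `\` N) (fun p => (F p.1 p.2)%:E).
  (* Integrability of the flux itself is the case [v = 1] of [integrable_flux_mul], available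
     because [Omega] has finite measure. *)
  have one2 : \int[mu]_(x in Omega) ((cst 1%R : T -> R) x ^+ 2)%:E < +oo.
    by under eq_integral do rewrite expr1n; rewrite integral_cst// mul1e.
  have := integrable_flux_mul cmu mN N0 mOmega mF (measurable_cst _) F2 one2.
  apply: eq_integrable => [|p _ /=]; last by rewrite mulr1.
  by apply: measurableD => //; exact: measurableX.
apply: (flux_integration_by_parts cmu mN N0 symN mOmega measurable_Gamma).
- by move=> y [].
- by move=> x y; rewrite /F opprB.
- exact: flux_vanish.
- exact: intF.
- exact: integrable_flux_mul.
- exact: (integrable_flux_mul_diff cmu mN N0 symN mOmega mgamma mk mG meas_u mv gamma0 k0
    gammaG gammakG kM u2 uG vG).
Qed.

End nonlocal_integration_by_parts.

(** * Completed measures *)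

Section outer_measure_hull.
Context d (T : measurableType d) (R : realType).
Variable m : {measure set T -> \bar R}.
Local Notation ms := (m^*)%mu.

(** The outer measure is an infimum over countable measurable covers: take covers with excess at
    most 1/(n+1) and intersect their unions. *)
Lemma measurable_hull (X : set T) : ms X < +oo ->
  exists G, [/\ measurable G, X `<=` G & m G = ms X].
Proof.
move=> Xoo.
have Xfin : ms X \is a fin_num by rewrite ge0_fin_numE// mu_ext_ge0.
have H (n : nat) : exists G, [/\ measurable G, X `<=` G &
    m G <= ms X + (n.+1%:R^-1)%:E].
  have n0 : (0 < n.+1%:R^-1 :> R)%R by rewrite invr_gt0.
  have [_ [F [mF XF] <-] Fle] := lb_ereal_inf_adherent n0 Xfin.
  exists (\bigcup_k F k); split=> //; first exact: bigcupT_measurable.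
  apply: le_trans (ltW Fle); apply: measure_sigma_subadditive => //.
  exact: bigcupT_measurable.
have [G /all_and3[mG XG Gle]] := choice H.
have mGi : measurable (\bigcap_k G k) by exact: bigcapT_measurable.
exists (\bigcap_k G k); split => //; first by move=> x Xx k _; exact: XG.
apply/eqP; rewrite eq_le; apply/andP; split.
  apply/lee_addgt0Pr => e e0.
  have [n ne] : exists n, (n.+1%:R^-1 < e)%R.
    exists (Num.truncn e^-1); rewrite invf_plt ?posrE//.
    exact: truncnS_gt.
  apply: le_trans (_ : m (G n) <= _).
    by apply: le_measure; rewrite ?inE//; exact: bigcap_inf.
  by apply: le_trans (Gle n) _; rewrite leeD2l// lee_fin ltW.
rewrite -measurable_mu_extE//; apply: le_mu_ext => x Xx k _; exact: XG.
Qed.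

(** Cut [A] into pieces of finite measure and take a hull of each; the excess is null because the
    piece is Caratheodory measurable. [N] is a hull of the union of the excesses. *)
Lemma cara_measurable_hull (A : set T) : sigma_finite setT m ->
  ms.-cara.-measurable A ->
  exists B N, [/\ measurable B, measurable N, m N = 0, A `<=` B & B `\` A `<=` N].
Proof.
move=> [S ST Sfin] mA.
have H n : exists G, [/\ measurable G, A `&` S n `<=` G & ms (G `\` (A `&` S n)) = 0].
  have [mS Soo] := Sfin n.
  have ASoo : ms (A `&` S n) < +oo.
    apply: le_lt_trans Soo; rewrite -(measurable_mu_extE m mS); apply: le_mu_ext.
    by move=> x [].
  have [G [mG AG GE]] := measurable_hull ASoo.
  exists G; split => //.
  have mAS : ms.-cara.-measurable (A `&` S n).
    apply: measurableI => //; apply: sub_caratheodory; exact: sub_sigma_algebra.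
  (* The Caratheodory criterion with test set [G] splits its measure into that of the piece and that
     of the excess; the former is finite and cancels. *)
  have := mAS G; rewrite /= (setIidr AG) (measurable_mu_extE m mG) GE.
  rewrite -setDE => GE2; have ASfin : ms (A `&` S n) \is a fin_num.
    by rewrite ge0_fin_numE// mu_ext_ge0.
  have : ms (A `&` S n) + ms (G `\` (A `&` S n)) - ms (A `&` S n) =
      ms (G `\` (A `&` S n)) by rewrite addeAC subee// add0e.
  by move=> <-; rewrite -[X in X - _]GE2 subee.
have [G /all_and3[mG AG G0]] := choice H.
pose X := \bigcup_n (G n `\` (A `&` S n)).
have X0 : ms X = 0.
  apply/eqP; rewrite eq_le mu_ext_ge0// andbT.
  apply: le_trans (outer_measure_sigma_subadditive ms _) _.
  by rewrite eseries0// => n _ _; exact: G0.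
have [|N [mN XN N0]] := @measurable_hull X; first by rewrite X0.
exists (\bigcup_n G n), N; split => //.
- exact: bigcupT_measurable.
- by rewrite N0.
- move=> x Ax; have : (\bigcup_n S n) x by rewrite -ST.
  by move=> [n _ Sx]; exists n => //; apply: AG; split.
- by move=> x [[n _ Gx] nA]; apply: XN; exists n => //; split=> // -[].
Qed.

(** Replace each set where [f] exceeds a given rational by a measurable hull, and discard the
    countable union of the null excesses. *)
Lemma cara_measurable_fun (f : T -> R) : sigma_finite setT m ->
  measurable_fun [set: caratheodory_type ms] f ->
  exists N, [/\ measurable N, m N = 0 & measurable_fun (~` N) f].
Proof.
(* [q] enumerates the rationals; numbers that encode none are sent to 0, which only repeats a
   value. *)
move=> sm mf; pose q n : R := ratr (odflt 0%R (unpickle n)).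
have H n : exists BN : set T * set T, [/\ measurable BN.1, measurable BN.2,
    m BN.2 = 0, f @^-1` `]q n, +oo[ `<=` BN.1 &
    BN.1 `\` f @^-1` `]q n, +oo[ `<=` BN.2].
  have [|B [N BN]] := @cara_measurable_hull (f @^-1` `]q n, +oo[) sm.
    by rewrite -[X in measurable X]setTI; exact: mf.
  by exists (B, N).
have [BN /all_and5[mB mN N0 fB BfN]] := choice H.
have mNN : measurable (\bigcup_n (BN n).2) by exact: bigcupT_measurable.
exists (\bigcup_n (BN n).2); split => //.
  apply: measure_negligible => //; apply: negligible_bigcup => n.
  by exists (BN n).2; split.
apply: (measurability _ (RGenOInfty.measurableE R)) => // _ [_ [r ->] <-].
(* Off the null set each hull coincides with the set where [f > q n], and the set where [f > r] is
   the union of these over [q n > r]. *)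
rewrite (_ : _ `&` _ = ~` (\bigcup_n (BN n).2) `&`
    \bigcup_n (if (r < q n)%R then (BN n).1 else set0)).
  apply: measurableI; first exact: measurableC.
  by apply: bigcupT_measurable => n; case: ifP.
apply/seteqP; split => x /= [nN].
  rewrite in_itv/= andbT => /rat_in_itvoo[p]; rewrite in_itv/= => /andP[rp pf].
  split => //; exists (pickle p) => //.
  have qp : q (pickle p) = ratr p by rewrite /q pickleK.
  by rewrite qp rp; apply: fB => /=; rewrite qp in_itv/= pf.
move=> [n _]; case: ifPn => // rq Bx; split => //.
have : (f @^-1` `]q n, +oo[) x.
  by apply: contrapT => nx; apply: nN; exists n => //; apply: BfN; split.
by rewrite /= !in_itv/= !andbT; exact: lt_trans.
Qed.

End outer_measure_hull.

(** * Open sets and bounded sets of row vectors *)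

(** The sigma-algebra is generated by coordinates, so an open set is written as the countable union
    of the boxes it contains with rational centre and radius 1/(k+1). *)
Lemma open_measurable_rV (R : realType) n (A : set 'rV[R]_n) :
  open A -> measurable A.
Proof.
move=> oA; pose J : Type := ({ffun 'I_n -> rat} * nat)%type.
pose box (j : J) := [set y : 'rV[R]_n |
  forall i, (`|ratr (j.1 i) - y ord0 i| < j.2.+1%:R^-1)%R].
have mbox j : measurable (box j).
  rewrite (_ : box j = \bigcap_i [set y : 'rV[R]_n |
      (`|ratr (j.1 i) - y ord0 i| < j.2.+1%:R^-1)%R]); last first.
    by apply/seteqP; split=> [x /= H i _|x /= H i]; exact: H.
  apply: fin_bigcap_measurable => [|i _]; first exact: finite_finset.
  rewrite -[X in measurable X]setTI.
  have mi : measurable_fun setT (fun y : 'rV[R]_n => `|ratr (j.1 i) - y ord0 i|%R).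
    apply: measurableT_comp => //; apply: measurable_funB => //.
    exact: measurable_coord.
  have := mi measurableT _ (measurable_itv `]-oo, j.2.+1%:R^-1%R[).
  by congr (measurable _); apply/seteqP; split=> y /=; rewrite in_itv.
rewrite (_ : A = \bigcup_(j : J) (if `[< box j `<=` A >] then box j else set0)).
  apply: countable_bigcupT_measurable; first exact: countableP.
  by move=> j; case: ifP.
apply/seteqP; split=> [x Ax|x [j _]]; last by case: asboolP => // jA; exact: jA.
have /nbhs_ballP[e /= e0 eA] : nbhs x A by exact: open_nbhs_nbhs.
(* Twice the radius 1/(k+1) is less than [e]: one radius separates [x] from the rational centre, the
   other the centre from any point of the box. *)
pose k := Num.truncn (2 / e)%R.
have k0 : (0 < k.+1%:R^-1 :> R)%R by rewrite invr_gt0.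
have ke : (k.+1%:R^-1 + k.+1%:R^-1 < e)%R.
  have : (2 / e < k.+1%:R)%R by exact: truncnS_gt.
  rewrite ltr_pdivrMr// => H.
  rewrite (_ : _ + _ = 2 / k.+1%:R)%R; last by rewrite mulr_natl mulr2n.
  by rewrite ltr_pdivrMr// mulrC.
have H i : exists q : rat, (`|ratr q - x ord0 i| < k.+1%:R^-1)%R.
  have [q] : exists q : rat, ratr q \in `]x ord0 i, (x ord0 i + k.+1%:R^-1)%R[.
    by apply: rat_in_itvoo; rewrite ltrDl.
  rewrite in_itv/= => /andP[xq qx]; exists q.
  by rewrite gtr0_norm ?subr_gt0// ltrBlDl.
have [c cx] := choice H.
exists ([ffun i => c i], k) => //.
have -> : `[< box ([ffun i => c i], k) `<=` A >].
  apply/asboolP => y yb; apply: eA; split => // a i; rewrite (ord1 a).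
  rewrite -ball_normE /ball_/=.
  have := yb i; rewrite /= ffunE => cy.
  rewrite (_ : x ord0 i - y ord0 i =
    - (ratr (c i) - x ord0 i) + (ratr (c i) - y ord0 i))%R; last by ring.
  apply: le_lt_trans (ler_normD _ _) _; rewrite normrN.
  by apply: lt_trans ke; apply: ltrD.
by move=> i; rewrite /= ffunE.
Qed.

Lemma borel_lebesgue_bounded (R : realType) n (A : set 'rV[R]_n) :
  measurable A -> bounded_set A -> borel_lebesgue n A < +oo.
Proof.
move=> mA /pinfty_ex_gt0[M M0 AM].
have mE : measurable [set x : 'rV[R]_n | forall i, (- M <= x ord0 i <= M)%R].
  rewrite (_ : mkset _ =
    \bigcap_i [set x : 'rV[R]_n | (- M <= x ord0 i <= M)%R]); last first.
    by apply/seteqP; split=> [x /= H i _|x /= H i]; exact: H.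
  apply: fin_bigcap_measurable => [|i _]; first exact: finite_finset.
  have := @measurable_coord R n i measurableT _ (measurable_itv `[(- M)%R, M]).
  by rewrite setTI; congr (measurable _); apply/seteqP; split=> y /=; rewrite in_itv.
apply: (@le_lt_trans _ _ (borel_lebesgue n
    [set x : 'rV[R]_n | forall i, (- M <= x ord0 i <= M)%R])).
  apply: le_measure; rewrite ?inE// => x Ax i; rewrite -ler_norml.
  apply: le_trans (AM x Ax); rewrite /Num.norm/= mx_normrE.
  exact: (le_bigmax _ (fun ij => `|x ij.1 ij.2|%R) (ord0, i)).
rewrite borel_lebesgue_box ?ltry// => i.
by apply: le_trans (ltW M0); rewrite oppr_le0 ltW.
Qed.

(** * Borel products inside products of completed measures *)

Section caratheodory_product.
Context d (T : measurableType d) (R : realType).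
Variable m : {sigma_finite_measure set T -> \bar R}.
Let C := caratheodory_type (m^*)%mu.
Variable mc : {sigma_finite_measure set C -> \bar R}.
Hypothesis mcE : forall A : set T, measurable A -> mc A = m A.

Lemma measurable_cara (A : set T) : measurable A -> measurable (A : set C).
Proof. by move=> mA; apply: sub_caratheodory; exact: sub_sigma_algebra. Qed.

(** The identity, with a finer sigma-algebra on the source; its measurability is the inclusion of
    sigma-algebras. *)
Let inj (p : C * C) : T * T := (p.1 : T, p.2 : T).

Let minj : measurable_fun setT inj.
Proof.
apply: measurable_fun_pair => _ Y mY; rewrite setTI.
- rewrite -[X in measurable X]setTI; apply: measurable_fst => //.
  exact: measurable_cara.
- rewrite -[X in measurable X]setTI; apply: measurable_snd => //.
  exact: measurable_cara.
Qed.

Lemma measurable_cara2 (X : set (T * T)) : measurable X -> measurable (X : set (C * C)).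
Proof.
move=> mX; have := minj measurableT mX; rewrite setTI.
by congr (measurable _); apply/seteqP; split=> -[].
Qed.

(** The pushforward of [mc \x mc] along the identity agrees with [m \x m] on rectangles, so
    uniqueness of the product measure applies. *)
Lemma product_measure_cara (X : set (T * T)) :
  measurable X -> (mc \x mc) (X : set (C * C)) = (m \x m) X.
Proof.
move=> mX.
pose m' : {measure set (T * T) -> \bar R} :=
  @measure_function_pushforward__canonical__measure_function_Measure
    _ _ _ _ _ (mc \x mc) inj minj.
rewrite (@product_measure_unique _ _ _ _ _ m m m' _ X mX) => [|A B mA mB].
  by congr ((mc \x mc) _); apply/seteqP; split=> -[].
have mA' := measurable_cara mA; have mB' := measurable_cara mB.
by rewrite -!mcE// -product_measure1E//.
Qed.

Lemma measurable_fun_cara2 (N : set (T * T)) (g : T * T -> R) : measurable N ->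
  measurable_fun (~` N) g -> measurable_fun (~` N : set (C * C)) (g : C * C -> R).
Proof.
move=> mN mg _ Y mY; apply: measurable_cara2.
by apply: mg => //; exact: measurableC.
Qed.

End caratheodory_product.

(* The library instance on [\x] is shadowed by a later one for probabilities. *)
Lemma sigma_finite_product_measure d1 d2 (T1 : measurableType d1)
    (T2 : measurableType d2) (R : realType)
    (m1 : {sigma_finite_measure set T1 -> \bar R})
    (m2 : {sigma_finite_measure set T2 -> \bar R}) :
  sigma_finite setT (m1 \x m2).
Proof.
have /sigma_finiteP[F [TF ndF Foo]] := sigma_finiteT m1.
have /sigma_finiteP[G [TG ndG Goo]] := sigma_finiteT m2.
exists (fun n => F n `*` G n).
  apply/esym/seteqP; split=> // -[x y] _.
  have [i _ Fx] : (\bigcup_i F i) x by rewrite -TF.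
  have [j _ Gy] : (\bigcup_j G j) y by rewrite -TG.
  exists (maxn i j) => //; split.
  - by move: x Fx; exact/subsetPset/ndF/leq_maxl.
  - by move: y Gy; exact/subsetPset/ndG/leq_maxr.
move=> n; have [mF Fn] := Foo n; have [mG Gn] := Goo n.
split; first exact: measurableX.
by rewrite product_measure1E// lte_mul_pinfty// ge0_fin_numE.
Qed.

(** Uniqueness of the product measure again: on rectangles the swap only exchanges two factors. *)
Lemma product_measure_swap d (T : measurableType d) (R : realType)
    (m : {sigma_finite_measure set T -> \bar R}) (X : set (T * T)) :
  measurable X -> (m \x m) (swap @^-1` X) = (m \x m) X.
Proof.
move=> mX.
have mswap : measurable_fun setT (@swap T T) by exact: measurable_swap.
pose m' : {measure set (T * T) -> \bar R} :=
  @measure_function_pushforward__canonical__measure_function_Measure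
    _ _ _ _ _ (m \x m) swap mswap.
rewrite [RHS](@product_measure_unique _ _ _ _ _ m m m' _ X mX)// => A B mA mB.
rewrite muleC -product_measure1E//=; congr ((m \x m) _).
by apply/seteqP; split=> -[x y] [].
Qed.

Lemma Lnorm_pinfty_ae_bound d (T : measurableType d) (R : realType)
    (mu : {measure set T -> \bar R}) (D : set T) (f : T -> \bar R) :
  'N[mu]_+oo [f \_ D] < +oo ->
  exists M : R, {ae mu, forall x, D x -> f x <= M%:E}.
Proof.
(* The norm is an essential supremum unless the whole space is null, in which case any bound holds
   a.e. *)
rewrite unlock; case: ifPn => [_ foo|]; last first.
  rewrite -leNgt measure_le0 => /eqP muT0; exists 0%R.
  by exists setT; split.
exists (fine (ess_sup mu (abse \o (f \_ D)))).
apply: filterS (ess_sup_ge mu (abse \o (f \_ D))) => x /= + Dx.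
rewrite patchE mem_set// => fx; apply: le_trans (lee_abs _) _.
apply: le_trans fx _.
(* The value [+oo] is excluded by [foo]; at [-oo] the function [fine] returns 0, still an upper
   bound. *)
move: foo; by case: (ess_sup _ _) => [r _|//|_] /=; rewrite ?lexx ?leNye.
Qed.

(** * Application to Lebesgue measure, and the flux balance from a constant test function *)

Unset Implicit Arguments.
Set Strict Implicit.

Theorem theorem2p4 (R : realType) (d : nat) (Omega : set 'rV[R]_d)
    (gamma k : 'rV[R]_d -> 'rV[R]_d -> R) (u : 'rV[R]_d -> R) :
  let mu := @lebesgue_rV R d in
  let Gamma := Gamma_hat Omega gamma in
  let L := nonlocal_op gamma u in
  let N := nonlocal_flux Omega gamma u in
  let flux := fun x y => (u x * gamma x y - u y * gamma y x)%R in
  Omega !=set0 -> open Omega -> bounded_set Omega ->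
  lebesgue_measurable2 gamma -> (forall x y, (0 <= gamma x y)%R) ->
  lebesgue_measurable2 k -> (forall x y, (0 < k x y)%R) ->
  'N[mu]_+oo [(fun x => \int[mu]_y (k y x)%:E) \_ Omega] < +oo ->
  V_space Omega (gamma_tilde gamma k) u ->
  \int[mu]_(x in Omega) ((\int[mu]_y `|flux x y|%:E) ^+ 2) < +oo ->
  (forall v, V_space Omega (gamma_tilde gamma k) v ->
    [/\ mu.-integrable Omega (fun x => L x * (v x)%:E),
        mu.-integrable Gamma (fun y => N y * (v y)%:E),
        mu.-integrable Omega
          (fun x => \int[mu]_(y in Omega) (flux x y * (v x - v y))%:E),
        mu.-integrable Omega
          (fun x => \int[mu]_(y in Gamma) (flux x y * (v x - v y))%:E) &
        \int[mu]_(x in Omega) (L x * (v x)%:E) +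
          \int[mu]_(y in Gamma) (N y * (v y)%:E) =
        (2^-1)%:E * \int[mu]_(x in Omega) \int[mu]_(y in Omega)
                      (flux x y * (v x - v y))%:E +
        \int[mu]_(x in Omega) \int[mu]_(y in Gamma)
                      (flux x y * (v x - v y))%:E]) /\
  [/\ mu.-integrable Omega L, mu.-integrable Gamma N &
      \int[mu]_(x in Omega) (- L x) = \int[mu]_(y in Gamma) N y].
Proof.
move=> mu Gamma L N flux _ oO bO mg g0 mk k0 kN [meas_u Vu] F2.
pose m := @borel_lebesgue R d.
pose C := caratheodory_type (m^*)%mu.
have cmu : measure_is_complete mu by exact: measure_is_complete_caratheodory.
have muE (A : set 'rV[R]_d) : measurable A -> mu A = m A.
  by move=> mA; rewrite /mu /lebesgue_rV /completed_measure_extension measurable_mu_extE.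
have mOb : measurable Omega by exact: open_measurable_rV.
have mO : measurable (Omega : set C) by exact: measurable_cara.
have Ofin : mu Omega < +oo by rewrite muE// borel_lebesgue_bounded.
have sm2 : sigma_finite setT (m \x m) by exact: sigma_finite_product_measure.
have [Ng [mNg Ng0 mgN]] := cara_measurable_fun sm2 mg.
have [Nk [mNk Nk0 mkN]] := cara_measurable_fun sm2 mk.
pose N0 := (Ng `|` Nk) : set ('rV[R]_d * 'rV[R]_d).
have mN0 : measurable N0 by exact: measurableU.
have mN0s : measurable (swap @^-1` N0).
  by rewrite -[X in measurable X]setTI; exact: measurable_swap.
(* Adding the reflection makes the exceptional set symmetric; it stays null because the product
   measure is invariant under the swap. *)
pose N1 := N0 `|` swap @^-1` N0.
have mN1 : measurable N1 by exact: measurableU.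
have N00 : (m \x m) N0 = 0 by apply: null_set_setU.
have N00s : (m \x m) (swap @^-1` N0) = 0 by rewrite product_measure_swap.
have N10 : (m \x m) N1 = 0 by apply: null_set_setU.
have symN1 x y : N1 (x, y) -> N1 (y, x) by case; [right|left].
have mgC : measurable_fun (~` N1 : set (C * C)) (fun p : C * C => gamma p.1 p.2).
  apply: measurable_fun_cara2 => //; apply: measurable_funS mgN; first exact: measurableC.
  by apply: subsetC => p; left; left.
have mkC : measurable_fun (~` N1 : set (C * C)) (fun p : C * C => k p.1 p.2).
  apply: measurable_fun_cara2 => //; apply: measurable_funS mkN; first exact: measurableC.
  by apply: subsetC => p; left; right.
have mN : measurable (N1 : set (C * C)) by exact: measurable_cara2.
have muN : (mu \x mu) (N1 : set (C * C)) = 0.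
  by rewrite -[RHS]N10; exact: product_measure_cara.
(* The arguments are transposed, as in the weight [eta y x] of [V_norm2]. *)
pose G (x y : C) := gamma_tilde gamma k y x.
have mG : measurable_fun (~` N1 : set (C * C)) (fun p : C * C => G p.1 p.2).
  have mgCs := measurable_fun_setC_swap mN symN1 mgC.
  have mkCs := measurable_fun_setC_swap mN symN1 mkC.
  apply: measurable_maxr => //; apply: measurable_funM.
    by apply: measurable_funX; exact: measurable_funB.
  (* The inverse of [k] is treated as a power with exponent -1, which is legitimate because [k] is
     positive. *)
  have := measurableT_comp (measurable_powR (-1)%R) mkCs.
  congr (measurable_fun _ _); apply/funext => p /=.
  by rewrite powR_inv1// ltW.
have [M kM] := Lnorm_pinfty_ae_bound kN.
(* Both terms of the norm are nonnegative, so each is finite. *)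
have split_V v : V_space Omega (gamma_tilde gamma k) v ->
    [/\ measurable_fun [set: C] v, \int[mu]_(x in Omega) (v x ^+ 2)%:E < +oo &
      \int[mu]_(x in Omega) \int[mu]_y ((v x - v y) ^+ 2 * G x y)%:E < +oo].
  move=> [mv Vv]; split => //; apply: le_lt_trans Vv.
  - rewrite leeDl//; apply: integral_ge0 => x _; apply: integral_ge0 => y _.
    by rewrite lee_fin mulr_ge0 ?sqr_ge0// /gamma_tilde le_max g0.
  - rewrite leeDr//; apply: integral_ge0 => x _.
    by rewrite lee_fin sqr_ge0.
have [_ u2 uG] := split_V _ (conj meas_u Vu).
have gG (x y : C) : (gamma y x <= G x y)%R by rewrite /G /gamma_tilde le_max lexx.
have kG (x y : C) : ((gamma x y - gamma y x) ^+ 2 <= k y x * G x y)%R.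
  by rewrite mulrC -ler_pdivrMr// /G /gamma_tilde le_max lexx orbT.
(* The kernel [k] enters transposed, since the essential bound concerns its integral in the first
   argument. *)
have ibp v mv v2 vG := @nonlocal_integration_by_parts _ C R mu cmu N1 mN muN symN1
  Omega gamma mO mgC g0 (fun x y => k y x) G u M Ofin
  (measurable_fun_setC_swap mN symN1 mkC) mG (fun x y => ltW (k0 y x)) gG kG kM
  meas_u u2 uG F2 v mv v2 vG.
split; first by move=> v /split_V[mv v2 vG]; exact: ibp.
(* The constant 1 is an admissible test function: [Omega] has finite measure and all differences are
   zero. It makes the right-hand side of the identity vanish. *)
have one2 : \int[mu]_(x in Omega) ((cst 1%R : 'rV[R]_d -> R) x ^+ 2)%:E < +oo.
  by under eq_integral do rewrite expr1n; rewrite integral_cst// mul1e.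
have oneG : \int[mu]_(x in Omega) \int[mu]_y
    (((cst 1%R : 'rV[R]_d -> R) x - (cst 1%R : 'rV[R]_d -> R) y) ^+ 2 * G x y)%:E < +oo.
  rewrite (_ : \int[mu]_(x in Omega) _ = 0) ?ltry//.
  apply: integral0_eq => x _; apply: integral0_eq => y _.
  by rewrite subrr expr0n mul0r.
have mGam : measurable (Gamma : set C).
  exact: (measurable_Gamma cmu mN muN symN1 mO mgC g0).
have [iL iN _ _ LN] := ibp (cst 1%R) (measurable_cst _) one2 oneG.
have iL1 : mu.-integrable Omega L by apply: eq_integrable iL => // x _; rewrite mule1.
have iN1 : mu.-integrable Gamma N by apply: eq_integrable iN => // x _; rewrite mule1.
split => //.
(* Finiteness of this integral is needed to move it across the equation in the extended reals. *)
have fL := integrable_fin_num mO iL1.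
have : \int[mu]_(x in Omega) L x + \int[mu]_(y in Gamma) N y = 0.
  transitivity (\int[mu]_(x in Omega) (L x * (cst 1%R x)%:E) +
      \int[mu]_(y in Gamma) (N y * (cst 1%R y)%:E)).
    by congr (_ + _); apply: eq_integral => x _; rewrite mule1.
  rewrite LN [X in _ * X]integral0_eq ?mule0 ?add0e => [|x _]; last first.
    by apply: integral0_eq => y _; rewrite subrr mulr0.
  by apply: integral0_eq => x _; apply: integral0_eq => y _; rewrite subrr mulr0.
rewrite integralN; last by rewrite integrable_add_def.
move=> LN0.
have : \int[mu]_(x in Omega) L x + \int[mu]_(y in Gamma) N y -
  \int[mu]_(x in Omega) L x = \int[mu]_(y in Gamma) N y.
  by rewrite addeAC subee// add0e.
by rewrite LN0 add0e.
Qed.
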